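(* Let $U(x,y,z)$ be the first coordinate of the tetrahedral superflow $\phi_{\widehat{\mathbb{T}}}(x,y,z)=(U(x,y,z),U(y,z,x),U(z,x,y))$, i.e. of the projective flow with vector field $(yz,xz,xy)$. (1) Assume that $x^2>z^2>y^2$. Put $v=\sqrt{x^2-y^2}$ and $k=\sqrt{\frac{x^2-z^2}{x^2-y^2}}$. Then $$U(x,y,z)=\frac{x(x^2-y^2)\,\mathrm{sn}'(v;k)+yz\sqrt{x^2-y^2}\;\mathrm{sn}(v;k)}{x^2-y^2-x^2\,\mathrm{sn}^2(v;k)},$$ where $\mathrm{sn}(\cdot\,;k)$ is the Jacobi elliptic function with modulus $k$ and $\mathrm{sn}'$ is its derivative with respect to the first variable. (2) Assume that $x^2>y^2$ and $z=x$. Then $$U(x,y,x)=\frac{x(x^2-y^2)\cos(\sqrt{x^2-y^2})+xy\sqrt{x^2-y^2}\,\sin(\sqrt{x^2-y^2})}{x^2\cos^2(\sqrt{x^2-y^2})-y^2}.$$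
   Context: A projective flow is a map $\phi$ such that $\phi^{t}(\mathbf{x})=t^{-1}\phi(\mathbf{x}t)$ satisfies $\phi^{t+s}=\phi^t\circ\phi^s$ (for $s,t$ small enough) and $\lim_{t\to0}\phi^t(\mathbf{x})=\mathbf{x}$; its vector field is $\frac{d}{dt}\phi^t(\mathbf{x})|_{t=0}$. Thus $\phi^t$ is the time-$t$ map of the system $\dot x=yz$, $\dot y=xz$, $\dot z=xy$, and $\phi=\phi^1$. The flow is local: the formulas are understood at $(xt,yt,zt)$ for $|t|$ small (the hypotheses on $x,y,z$ are homogeneous), and by analytic continuation along the integral curve as long as it exists. The modulus convention is $\mathrm{sn}^2+\mathrm{cn}^2=1$, $k^2\mathrm{sn}^2+\mathrm{dn}^2=1$, $\mathrm{sn}'=\mathrm{cn}\,\mathrm{dn}$. Variables are real and square roots are positive. *)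

(* Defs.v *)
From Stdlib Require Import Reals.
From Coquelicot Require Import Coquelicot.

Open Scope R_scope.

(* Flows are local. A partially defined map is represented by a total function
   whose values off the domain of the flow are unconstrained. *)

(* phi^t(p) = t^{-1} phi(p t), completed by phi^0(p) = p. *)
Definition flow_at {V : NormedModule R_AbsRing} (phi : V -> V) (t : R) (p : V) : V :=
  if Req_EM_T t 0 then p else scal (/ t) (phi (scal t p)).

Definition projective_flow {V : NormedModule R_AbsRing} (phi : V -> V) : Prop :=
  (forall p : V, exists eps : R, 0 < eps /\
     forall s t : R, Rabs s < eps -> Rabs t < eps ->
       flow_at phi (t + s) p = flow_at phi t (flow_at phi s p)) /\
  (forall p : V, filterlim (fun t : R => flow_at phi t p) (locally' 0) (locally p)).

Definition has_vector_field {V : NormedModule R_AbsRing} (phi X : V -> V) : Prop :=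
  forall p : V, is_derive (fun t : R => flow_at phi t p) 0 (X p).

(* The integral curve of X from p exists on a neighbourhood of [0, 1] and is
   at q at time 1. *)
Definition time_one {V : NormedModule R_AbsRing} (X : V -> V) (p q : V) : Prop :=
  exists (gamma : R -> V) (a b : R), a < 0 /\ 1 < b /\
    (forall t : R, a < t < b -> is_derive gamma t (X (gamma t))) /\
    gamma 0 = p /\ gamma 1 = q.

Definition flow_domain {V : NormedModule R_AbsRing} (X : V -> V) (p : V) : Prop :=
  exists q : V, time_one X p q.

(* The first two clauses only constrain phi near the origin of each line; the
   third one continues phi along integral curves for as long as they exist. *)
Definition projective_flow_of {V : NormedModule R_AbsRing} (X phi : V -> V) : Prop :=
  projective_flow phi /\ has_vector_field phi X /\
  (forall p q : V, time_one X p q -> phi p = q).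

Definition tetrahedral_field (p : R * R * R) : R * R * R :=
  let '(x, y, z) := p in (y * z, x * z, x * y).

Definition tetrahedral_superflow (phi : R * R * R -> R * R * R) : Prop :=
  projective_flow_of tetrahedral_field phi.

(* Jacobi elliptic sine with modulus (not parameter) k, for k^2 < 1:
   sn(u; k) = sin(am(u; k)), where the amplitude am(.; k) is the inverse of
   a |-> int_0^a dtheta / sqrt(1 - k^2 sin^2 theta). *)
Definition elliptic_F (a k : R) : R :=
  RInt (fun theta : R => / sqrt (1 - k ^ 2 * sin theta ^ 2)) 0 a.

Definition jacobi_am (u k : R) : R := iota (fun a : R => elliptic_F a k = u).

Definition jacobi_sn (u k : R) : R := sin (jacobi_am u k).

Definition jacobi_sn' (u k : R) : R := Derive (fun w : R => jacobi_sn w k) u.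

(* "U = num / den at (x, y, z)" for the local flow of the tetrahedral field: the
   identity holds at (xt, yt, zt) for all small t <> 0, and it holds at
   (x, y, z) itself whenever the flow is defined there. In the latter case den
   may vanish although the integral curve is regular (num then vanishes too),
   and the quotient is understood as its limit along the line, t -> 1. *)
Definition equals_quotient (U num den : R -> R -> R -> R) (x y z : R) : Prop :=
  (exists eps : R, 0 < eps /\
     forall t : R, 0 < Rabs t < eps ->
       den (x * t) (y * t) (z * t) <> 0 /\
       U (x * t) (y * t) (z * t) =
         num (x * t) (y * t) (z * t) / den (x * t) (y * t) (z * t)) /\
  (flow_domain tetrahedral_field (x, y, z) ->
     (den x y z <> 0 -> U x y z = num x y z / den x y z) /\
     is_lim (fun t : R => num (x * t) (y * t) (z * t) / den (x * t) (y * t) (z * t))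
            1 (U x y z)).

(* Main.v *)
Require Import Defs.
From Stdlib Require Import Reals Lra Ranalysis5.
From Coquelicot Require Import Coquelicot.
Open Scope R_scope.

(** Along an integral curve of [(yz, xz, xy)] the quantities [x^2 - y^2 = r^2] and
    [x^2 - z^2 = k^2 r^2] are constant, so [x'^2 = (x^2 - r^2) (x^2 - k^2 r^2)]. This
    is the differential equation of [r / sn (w0 - r t; k)], and the addition theorems
    express the solution rationally through [sn, cn, dn] at [r t].

    There are two such expressions for the first coordinate. The one to be proved has
    denominator [r^2 - x^2 sn^2], which also vanishes at times where the curve is
    perfectly regular. The other one, [flow_x = r N / M] with
    [M = r x cn dn - y z sn] and [N = x^2 cn^2 + z^2 sn^2 > 0], has poles exactly where
    the curve blows up. Therefore the second one is compared with the flow: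

    - it solves the system wherever [M <> 0], by a polynomial identity
      ([closed_form_solves_at], [flow_solves]);
    - by uniqueness ([solution_unique]) it agrees with any integral curve up to the
      first zero of [M], and at such a zero the relation [x(t) M = r N] would say
      [0 > 0]. So [M] has no zero as long as the curve exists ([flow_den_nonzero]).

    The two expressions are related by [(r^2 - x^2 sn^2) N = M(t) M(-t)]
    ([flow_den_factor]), while the numerator of the first is [r M(-t)]. They agree
    outside the zeros of [M(-t)], which are simple, hence isolated
    ([flow_den_simple_zeros]); at these zeros the first expression has the second one
    as its limit. Homogeneity of the field turns the solution at time [t] into the
    value of the flow at the point scaled by [t] ([time_one_curve]), which gives the
    identity for small [t] as well.

    The trigonometric formula is the case [z = x] of the elliptic one: the modulus is
    [0] and [sn (.; 0) = sin]. The three coordinates of the flow are the same function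
    because the field commutes with cyclic permutations ([time_one_rotate]). *)

(** * Jacobi elliptic functions *)

Definition jacobi_cn (u k : R) : R := cos (jacobi_am u k).
(** For [k ^ 2 < 1] the quantity under the root is positive, so [dn] never changes
    sign and the positive root is the right branch everywhere. *)
Definition jacobi_dn (u k : R) : R := sqrt (1 - k ^ 2 * jacobi_sn u k ^ 2).

Lemma modulus_delta_pos (k a : R) : k ^ 2 < 1 -> 0 < 1 - k ^ 2 * sin a ^ 2.
Proof.
  intros Hk; pose proof (sin2_cos2 a) as H; unfold Rsqr in H.
  assert (0 <= sin a ^ 2 <= 1) by nra. assert (0 <= k ^ 2) by nra. nra.
Qed.

Lemma elliptic_F_is_derive (k a : R) : k ^ 2 < 1 ->
  is_derive (fun a => elliptic_F a k) a (/ sqrt (1 - k ^ 2 * sin a ^ 2)).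
Proof.
  intros Hk.
  assert (Hc : forall b, continuous (fun t : R => / sqrt (1 - k ^ 2 * sin t ^ 2)) b).
  { intros b. apply (ex_derive_continuous (fun t : R => / sqrt (1 - k ^ 2 * sin t ^ 2))).
    auto_derive. pose proof (modulus_delta_pos k b Hk) as H.
    pose proof (sqrt_lt_R0 _ H). unfold Rminus in *. simpl in *. repeat split; lra. }
  unfold elliptic_F. apply (is_derive_RInt (fun t : R => / sqrt (1 - k ^ 2 * sin t ^ 2)) _ 0 a); [|apply Hc].
  apply filter_forall; intros b.
  apply (RInt_correct (V := R_CompleteNormedModule)), (ex_RInt_continuous (V := R_CompleteNormedModule)).
  intros; apply Hc.
Qed.

Lemma elliptic_F_0 (k : R) : elliptic_F 0 k = 0.
Proof. unfold elliptic_F; now rewrite RInt_point. Qed.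

(** The integrand is at least [1]. This single inequality makes the integral
    injective and unbounded in both directions, and its inverse continuous. *)
Lemma elliptic_F_expands (k a b : R) : k ^ 2 < 1 -> a <= b ->
  b - a <= elliptic_F b k - elliptic_F a k.
Proof.
  intros Hk Hab.
  destruct (MVT_gen (fun a => elliptic_F a k) a b (fun a => / sqrt (1 - k ^ 2 * sin a ^ 2)))
    as [c [_ Hc]].
  - intros; now apply elliptic_F_is_derive.
  - intros c _. apply continuity_pt_filterlim, (ex_derive_continuous (fun a => elliptic_F a k)).
    eexists; now apply elliptic_F_is_derive.
  - rewrite Hc.
    assert (1 <= / sqrt (1 - k ^ 2 * sin c ^ 2)).
    { pose proof (modulus_delta_pos k c Hk) as H. rewrite <- Rinv_1 at 1.
      apply Rinv_le_contravar; [now apply sqrt_lt_R0|].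
      rewrite <- sqrt_1 at 2. apply sqrt_le_1_alt.
      assert (0 <= k ^ 2 * sin c ^ 2) by (rewrite <- Rpow_mult_distr; apply pow2_ge_0). lra. }
    nra.
Qed.

Lemma elliptic_F_inj (k a b : R) : k ^ 2 < 1 -> elliptic_F a k = elliptic_F b k -> a = b.
Proof.
  intros Hk H. destruct (Rle_lt_dec a b) as [L|L].
  - pose proof (elliptic_F_expands k a b Hk L). lra.
  - pose proof (elliptic_F_expands k b a Hk (Rlt_le _ _ L)). lra.
Qed.

(** The description of the amplitude by a property has meaning because exactly one
    angle has that property: existence by the intermediate value theorem,
    uniqueness by monotonicity. *)
Lemma elliptic_F_am (k u : R) : k ^ 2 < 1 -> elliptic_F (jacobi_am u k) k = u.
Proof.
  intros Hk. unfold jacobi_am.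
  apply (iota_correct (V := R_CompleteNormedModule) (fun a : R => elliptic_F a k = u)).
  destruct (IVT_gen (fun a => elliptic_F a k) (- Rabs u) (Rabs u) u) as [a [_ Ha]].
  - intros c. apply continuity_pt_filterlim, (ex_derive_continuous (fun a => elliptic_F a k)).
    eexists; now apply elliptic_F_is_derive.
  - pose proof (Rabs_pos u). pose proof (Rle_abs u). pose proof (Rle_abs (- u)).
    rewrite Rabs_Ropp in *.
    pose proof (elliptic_F_expands k 0 (Rabs u) Hk ltac:(lra)).
    pose proof (elliptic_F_expands k (- Rabs u) 0 Hk ltac:(lra)).
    rewrite elliptic_F_0 in *. rewrite Rmin_left, Rmax_right by lra. lra.
  - exists a. split; [exact Ha|].
    intros b Hb. apply (elliptic_F_inj k); congruence || lra.
Qed.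

Lemma am_elliptic_F (k a : R) : k ^ 2 < 1 -> jacobi_am (elliptic_F a k) k = a.
Proof. intros Hk. apply (elliptic_F_inj k); [easy|now apply elliptic_F_am]. Qed.

Lemma elliptic_F_opp (k a : R) : k ^ 2 < 1 -> elliptic_F (- a) k = - elliptic_F a k.
Proof.
  intros Hk.
  assert (Hd : forall c, is_derive (fun a => elliptic_F (- a) k + elliptic_F a k) c 0).
  { intros c. evar_last.
    - apply (is_derive_plus (fun a => elliptic_F (- a) k) (fun a => elliptic_F a k)).
      + apply (is_derive_comp (fun a => elliptic_F a k) Ropp); [now apply elliptic_F_is_derive|].
        apply (is_derive_opp (fun t : R => t)), (is_derive_id (K := R_AbsRing)).
      + now apply elliptic_F_is_derive.
    - rewrite sin_neg. replace ((- sin c) ^ 2) with (sin c ^ 2) by ring.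
      unfold plus, opp, scal, one; simpl; unfold mult; simpl. ring. }
  destruct (MVT_gen (fun a => elliptic_F (- a) k + elliptic_F a k) 0 a (fun _ => 0)) as [c [_ Hc]].
  - intros; apply Hd.
  - intros c _. apply continuity_pt_filterlim,
      (ex_derive_continuous (fun a => elliptic_F (- a) k + elliptic_F a k)).
    eexists; apply Hd.
  - rewrite Ropp_0, elliptic_F_0 in Hc. lra.
Qed.

Lemma jacobi_am_opp (k u : R) : k ^ 2 < 1 -> jacobi_am (- u) k = - jacobi_am u k.
Proof.
  intros Hk. apply (elliptic_F_inj k); [easy|].
  now rewrite elliptic_F_opp, !elliptic_F_am by easy.
Qed.

Lemma jacobi_am_0 (k : R) : k ^ 2 < 1 -> jacobi_am 0 k = 0.
Proof. intros Hk. rewrite <- (elliptic_F_0 k) at 1. now apply am_elliptic_F. Qed.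

Lemma jacobi_am_modulus_0 (u : R) : jacobi_am u 0 = u.
Proof.
  transitivity (elliptic_F (jacobi_am u 0) 0); [|apply elliptic_F_am; lra].
  unfold elliptic_F. rewrite (RInt_ext _ (fun _ => 1)).
  - rewrite RInt_const. change (jacobi_am u 0 = (jacobi_am u 0 - 0) * 1). ring.
  - intros x _. replace (1 - 0 ^ 2 * sin x ^ 2) with 1 by ring. rewrite sqrt_1. apply Rinv_1.
Qed.

Lemma jacobi_am_nonexpansive (k u w : R) : k ^ 2 < 1 ->
  Rabs (jacobi_am w k - jacobi_am u k) <= Rabs (w - u).
Proof.
  intros Hk.
  pose proof (elliptic_F_am k u Hk). pose proof (elliptic_F_am k w Hk).
  destruct (Rle_lt_dec (jacobi_am u k) (jacobi_am w k)) as [L|L].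
  - pose proof (elliptic_F_expands k _ _ Hk L). rewrite !Rabs_pos_eq; lra.
  - pose proof (elliptic_F_expands k _ _ Hk (Rlt_le _ _ L)). rewrite !Rabs_left1; lra.
Qed.

(** Inverse function theorem: [F' = 1 / sqrt (1 - k^2 sin^2)], so its inverse has
    derivative [sqrt (1 - k^2 sin^2 am) = dn]. *)
Lemma jacobi_am_is_derive (k u : R) : k ^ 2 < 1 ->
  is_derive (fun u => jacobi_am u k) u (jacobi_dn u k).
Proof.
  intros Hk.
  assert (Hd : forall a, derivable_pt_lim (fun a => elliptic_F a k) a (/ sqrt (1 - k ^ 2 * sin a ^ 2))).
  { intros a. now apply is_derive_Reals, elliptic_F_is_derive. }
  assert (Hcont : continuity_pt (fun u => jacobi_am u k) u).
  { intros eps Heps. exists eps. split; [easy|]. intros w [_ Hw].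
    eapply Rle_lt_trans; [now apply (jacobi_am_nonexpansive k u w)|exact Hw]. }
  assert (Hmono : forall w1 w2, w1 <= w2 -> jacobi_am w1 k <= jacobi_am w2 k).
  { intros w1 w2 Hw. destruct (Rle_lt_dec (jacobi_am w1 k) (jacobi_am w2 k)) as [L|L]; [easy|].
    pose proof (elliptic_F_expands k _ _ Hk (Rlt_le _ _ L)) as HF.
    rewrite !elliptic_F_am in HF by easy. lra. }
  apply is_derive_Reals.
  pose (Prf := fun a (_ : jacobi_am (u - 1) k <= a <= jacobi_am (u + 1) k) =>
     exist (fun l => derivable_pt_abs (fun a => elliptic_F a k) a l) _ (Hd a)).
  pose (Hin := conj (Hmono (u - 1) u ltac:(lra)) (Hmono u (u + 1) ltac:(lra))).
  replace (jacobi_dn u k) with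
    (1 / derive_pt (fun a => elliptic_F a k) (jacobi_am u k) (Prf (jacobi_am u k) Hin)).
  - apply (derivable_pt_lim_recip_interv (fun a => elliptic_F a k) (fun u => jacobi_am u k)
      (u - 1) (u + 1) u Prf Hcont ltac:(lra) ltac:(lra) Hin).
    + intros w _. now apply elliptic_F_am.
    + simpl. pose proof (sqrt_lt_R0 _ (modulus_delta_pos k (jacobi_am u k) Hk)) as Hs.
      simpl in Hs. apply Rinv_neq_0_compat. lra.
  - unfold jacobi_dn, jacobi_sn. unfold derive_pt. cbn [proj1_sig Prf].
    pose proof (sqrt_lt_R0 _ (modulus_delta_pos k (jacobi_am u k) Hk)) as Hs. field. lra.
Qed.

Lemma jacobi_sn_cn_sqr (u k : R) : jacobi_cn u k ^ 2 = 1 - jacobi_sn u k ^ 2.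
Proof.
  unfold jacobi_cn, jacobi_sn. pose proof (sin2_cos2 (jacobi_am u k)) as H.
  unfold Rsqr in H. lra.
Qed.

Lemma jacobi_dn_sqr (u k : R) : k ^ 2 < 1 -> jacobi_dn u k ^ 2 = 1 - k ^ 2 * jacobi_sn u k ^ 2.
Proof. intros Hk. unfold jacobi_dn. apply pow2_sqrt, Rlt_le. now apply modulus_delta_pos. Qed.

Lemma jacobi_dn_pos (u k : R) : k ^ 2 < 1 -> 0 < jacobi_dn u k.
Proof. intros Hk. now apply sqrt_lt_R0, modulus_delta_pos. Qed.

Lemma jacobi_sn_is_derive (k u : R) : k ^ 2 < 1 ->
  is_derive (fun u => jacobi_sn u k) u (jacobi_cn u k * jacobi_dn u k).
Proof.
  intros Hk. evar_last.
  - apply (is_derive_comp sin (fun u => jacobi_am u k)); [apply is_derive_sin|now apply jacobi_am_is_derive].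
  - apply Rmult_comm.
Qed.

Lemma jacobi_cn_is_derive (k u : R) : k ^ 2 < 1 ->
  is_derive (fun u => jacobi_cn u k) u (- jacobi_sn u k * jacobi_dn u k).
Proof.
  intros Hk. evar_last.
  - apply (is_derive_comp cos (fun u => jacobi_am u k)); [apply is_derive_cos|now apply jacobi_am_is_derive].
  - apply Rmult_comm.
Qed.

Lemma jacobi_dn_is_derive (k u : R) : k ^ 2 < 1 ->
  is_derive (fun u => jacobi_dn u k) u (- k ^ 2 * jacobi_sn u k * jacobi_cn u k).
Proof.
  intros Hk. pose proof (jacobi_dn_pos u k Hk) as Hp. unfold jacobi_dn at 1. evar_last.
  - apply (is_derive_sqrt (fun u => 1 - k ^ 2 * jacobi_sn u k ^ 2) u
      (- (k ^ 2 * (2 * jacobi_sn u k * (jacobi_cn u k * jacobi_dn u k))))); [|now apply modulus_delta_pos].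
    evar_last.
    + apply (is_derive_minus (fun _ => 1) (fun u => k ^ 2 * jacobi_sn u k ^ 2)).
      * apply is_derive_const.
      * apply is_derive_scal, is_derive_pow. now apply jacobi_sn_is_derive.
    + unfold minus, plus, opp, zero; simpl. ring.
  - fold (jacobi_dn u k). simpl. field. lra.
Qed.

Lemma jacobi_sn'_eq (u k : R) : k ^ 2 < 1 -> jacobi_sn' u k = jacobi_cn u k * jacobi_dn u k.
Proof. intros Hk. now apply (is_derive_unique (fun w => jacobi_sn w k)), jacobi_sn_is_derive. Qed.

Lemma jacobi_at_0 (k : R) : k ^ 2 < 1 ->
  jacobi_sn 0 k = 0 /\ jacobi_cn 0 k = 1 /\ jacobi_dn 0 k = 1.
Proof.
  intros Hk. unfold jacobi_dn, jacobi_cn, jacobi_sn. rewrite jacobi_am_0, sin_0, cos_0 by easy.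
  repeat split. replace (1 - k ^ 2 * 0 ^ 2) with 1 by ring. apply sqrt_1.
Qed.

(** Parity is what makes the closed formula valid for negative times, where the
    argument [sqrt (x^2 t^2 - y^2 t^2)] is [- r t] instead of [r t]. *)
Lemma jacobi_parity (u k : R) : k ^ 2 < 1 ->
  jacobi_sn (- u) k = - jacobi_sn u k /\ jacobi_cn (- u) k = jacobi_cn u k /\
  jacobi_dn (- u) k = jacobi_dn u k.
Proof.
  intros Hk. unfold jacobi_dn, jacobi_cn, jacobi_sn.
  rewrite jacobi_am_opp, sin_neg, cos_neg by easy.
  repeat split. f_equal. ring.
Qed.

(** At modulus [0] the amplitude is the identity, which is how the trigonometric
    formula arises from the elliptic one. *)
Lemma jacobi_modulus_0 (u : R) : jacobi_sn u 0 = sin u /\ jacobi_sn' u 0 = cos u.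
Proof.
  rewrite jacobi_sn'_eq by lra. unfold jacobi_dn, jacobi_cn, jacobi_sn. rewrite jacobi_am_modulus_0.
  split; [easy|]. replace (1 - 0 ^ 2 * sin u ^ 2) with 1 by ring. rewrite sqrt_1. ring.
Qed.

(** * Integral curves of the tetrahedral field *)

Lemma is_derive_pair {V W : NormedModule R_AbsRing} (f : R -> V) (g : R -> W) (t : R) (df : V) (dg : W) :
  is_derive f t df -> is_derive g t dg ->
  is_derive (V := prod_NormedModule _ V W) (fun t => (f t, g t)) t (df, dg).
Proof.
  intros Hf Hg.
  apply (filterdiff_comp'_2 f g (fun v w => (v, w)) t _ _ (fun v w => (v, w)) Hf Hg).
  apply (filterdiff_linear (V := prod_NormedModule _ V W) (fun u : V * W => (fst u, snd u))),
    (is_linear_prod (T := prod_NormedModule _ V W)).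
  - apply is_linear_fst.
  - apply is_linear_snd.
Qed.

Lemma is_derive_fst {V W : NormedModule R_AbsRing} (f : R -> V * W) (t : R) (l : V * W) :
  is_derive (V := prod_NormedModule _ V W) f t l -> is_derive (fun t => fst (f t)) t (fst l).
Proof.
  intros Hf.
  apply (filterdiff_comp' (V := prod_NormedModule _ V W) f fst t _ fst Hf).
  apply filterdiff_linear, is_linear_fst.
Qed.

Lemma is_derive_snd {V W : NormedModule R_AbsRing} (f : R -> V * W) (t : R) (l : V * W) :
  is_derive (V := prod_NormedModule _ V W) f t l -> is_derive (fun t => snd (f t)) t (snd l).
Proof.
  intros Hf.
  apply (filterdiff_comp' (V := prod_NormedModule _ V W) f snd t _ snd Hf).
  apply filterdiff_linear, is_linear_snd.
Qed.

Definition solves_at (f g h : R -> R) (t : R) : Prop :=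
  is_derive f t (g t * h t) /\ is_derive g t (f t * h t) /\ is_derive h t (f t * g t).

Lemma is_derive_tetrahedral_iff (gamma : R -> R * R * R) (t : R) :
  is_derive gamma t (tetrahedral_field (gamma t)) <->
  solves_at (fun t => fst (fst (gamma t))) (fun t => snd (fst (gamma t))) (fun t => snd (gamma t)) t.
Proof.
  unfold solves_at. split.
  - intros H.
    pose proof (is_derive_fst _ _ _ (is_derive_fst gamma _ _ H)) as H1.
    pose proof (is_derive_snd _ _ _ (is_derive_fst gamma _ _ H)) as H2.
    pose proof (is_derive_snd gamma _ _ H) as H3.
    destruct (gamma t) as [[x y] z]; easy.
  - intros (H1 & H2 & H3).
    apply (is_derive_ext (fun t => (fst (fst (gamma t)), snd (fst (gamma t)), snd (gamma t)))).
    { intros u. now destruct (gamma u) as [[x y] z]. }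
    pose proof (is_derive_pair _ _ _ _ _ (is_derive_pair _ _ _ _ _ H1 H2) H3) as H.
    now destruct (gamma t) as [[x y] z].
Qed.

Lemma continuous_bounded (f : R -> R) (a b : R) : (forall t, a <= t <= b -> continuous f t) ->
  exists B, 0 <= B /\ forall t, a <= t <= b -> Rabs (f t) <= B.
Proof.
  intros Hf. destruct (bounded_continuity f a b Hf) as [B HB].
  exists (Rabs B). split; [apply Rabs_pos|].
  intros t Ht. left. eapply Rlt_le_trans; [apply HB, Ht|apply Rle_abs].
Qed.

(** Gronwall: [w exp (- L t)] does not increase. *)
Lemma gronwall_zero (w w' : R -> R) (L T : R) : 0 <= T ->
  (forall t, 0 <= t <= T -> is_derive w t (w' t)) ->
  (forall t, 0 <= t <= T -> w' t <= L * w t) ->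
  w 0 = 0 -> w T <= 0.
Proof.
  intros HT Hd HL H0.
  assert (He : forall t, 0 <= t <= T ->
    is_derive (fun t => w t * exp (- L * t)) t ((w' t - L * w t) * exp (- L * t))).
  { intros t Ht. evar_last.
    - apply (Derive.is_derive_mult w (fun t => exp (- L * t))); [apply Hd, Ht|].
      auto_derive; [easy|reflexivity].
    - simpl. ring. }
  destruct (MVT_gen (fun t => w t * exp (- L * t)) 0 T
     (fun t => (w' t - L * w t) * exp (- L * t))) as [c [Hc HE]].
  - rewrite Rmin_left, Rmax_right by lra. intros; apply He; lra.
  - rewrite Rmin_left, Rmax_right by lra. intros t Ht.
    apply continuity_pt_filterlim, (ex_derive_continuous (fun t => w t * exp (- L * t))).
    eexists; now apply He.
  - rewrite Rmin_left, Rmax_right in Hc by lra. specialize (HL c Hc).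
    rewrite H0 in HE. pose proof (exp_pos (- L * T)). pose proof (exp_pos (- L * c)).
    assert (0 <= (L * w c - w' c) * exp (- L * c)) by (apply Rmult_le_pos; lra). nra.
Qed.

Lemma solves_continuous (f g h : R -> R) (t : R) : solves_at f g h t ->
  continuous f t /\ continuous g t /\ continuous h t.
Proof.
  intros (H1 & H2 & H3).
  split; [|split];
    [apply (ex_derive_continuous f)|apply (ex_derive_continuous g)|apply (ex_derive_continuous h)];
    eexists; eassumption.
Qed.

(** The eta-expanded shape is the one that [auto_derive] leaves for the derivative
    of an abstract function. *)
Lemma Derive_eta_unique (f : R -> R) (t l : R) : is_derive f t l -> Derive (fun x : R => f x) t = l.
Proof. exact (is_derive_unique f t l). Qed.

(** On a compact interval both solutions are bounded by some [B], and there the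
    squared distance [w] satisfies [w' <= 4 B w]. *)
Lemma solution_unique (f g h f' g' h' : R -> R) (T : R) : 0 <= T ->
  (forall t, 0 <= t <= T -> solves_at f g h t) ->
  (forall t, 0 <= t <= T -> solves_at f' g' h' t) ->
  f 0 = f' 0 -> g 0 = g' 0 -> h 0 = h' 0 ->
  f T = f' T /\ g T = g' T /\ h T = h' T.
Proof.
  intros HT H H' Ef Eg Eh.
  assert (HB : exists B, 0 <= B /\ forall t, 0 <= t <= T ->
    Rabs (g t) <= B /\ Rabs (f t) <= B /\ Rabs (f' t) <= B /\ Rabs (h' t) <= B /\ Rabs (g' t) <= B).
  { destruct (continuous_bounded f 0 T) as [B1 [P1 H1]]; [intros; now apply (solves_continuous f g h), H|].
    destruct (continuous_bounded g 0 T) as [B2 [P2 H2]]; [intros; now apply (solves_continuous f g h), H|].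
    destruct (continuous_bounded f' 0 T) as [B3 [P3 H3]]; [intros; now apply (solves_continuous f' g' h'), H'|].
    destruct (continuous_bounded g' 0 T) as [B4 [P4 H4]]; [intros; now apply (solves_continuous f' g' h'), H'|].
    destruct (continuous_bounded h' 0 T) as [B5 [P5 H5]]; [intros; now apply (solves_continuous f' g' h'), H'|].
    exists (B1 + B2 + B3 + B4 + B5). split; [lra|]. intros t Ht.
    specialize (H1 t Ht); specialize (H2 t Ht); specialize (H3 t Ht);
    specialize (H4 t Ht); specialize (H5 t Ht); repeat split; lra. }
  destruct HB as [B [HB0 HB]].
  assert (Hw : (f T - f' T) ^ 2 + (g T - g' T) ^ 2 + (h T - h' T) ^ 2 <= 0).
  { apply (gronwall_zero (fun t => (f t - f' t) ^ 2 + (g t - g' t) ^ 2 + (h t - h' t) ^ 2)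
      (fun t => 2 * ((f t - f' t) * (g t * h t - g' t * h' t) + (g t - g' t) * (f t * h t - f' t * h' t)
          + (h t - h' t) * (f t * g t - f' t * g' t))) (4 * B) T HT).
    - intros t Ht. destruct (H t Ht) as (D1 & D2 & D3). destruct (H' t Ht) as (D1' & D2' & D3').
      auto_derive; [repeat split; eexists; eassumption|].
      rewrite (Derive_eta_unique _ _ _ D1), (Derive_eta_unique _ _ _ D2), (Derive_eta_unique _ _ _ D3),
       (Derive_eta_unique _ _ _ D1'), (Derive_eta_unique _ _ _ D2'), (Derive_eta_unique _ _ _ D3'). ring.
    - intros t Ht. destruct (HB t Ht) as (B1 & B2 & B3 & B4 & B5).
      assert (K : forall m u v, Rabs m <= B -> 2 * (m * u * v) <= B * (u ^ 2 + v ^ 2)).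
      { intros m u v Hm. apply Rabs_le_between in Hm.
        assert (0 <= (B - m) * (u + v) ^ 2) by (apply Rmult_le_pos; [lra | apply pow2_ge_0]).
        assert (0 <= (B + m) * (u - v) ^ 2) by (apply Rmult_le_pos; [lra | apply pow2_ge_0]).
        lra. }
      (* Each product difference is linear in [u, v, q] with coefficients bounded by [B];
         every one of the six resulting cross terms costs at most [B] times two squares. *)
      set (u := f t - f' t). set (v := g t - g' t). set (q := h t - h' t).
      pose proof (K (g t) u q B1). pose proof (K (h' t) u v B4).
      pose proof (K (f t) v q B2). pose proof (K (h' t) v u B4).
      pose proof (K (f t) q v B2). pose proof (K (g' t) q u B5).
      assert (0 <= B * u ^ 2) by (apply Rmult_le_pos; [lra | nra]).
      assert (0 <= B * v ^ 2) by (apply Rmult_le_pos; [lra | nra]).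
      assert (0 <= B * q ^ 2) by (apply Rmult_le_pos; [lra | nra]).
      replace (g t * h t - g' t * h' t) with (g t * q + h' t * v) by (unfold q, v; ring).
      replace (f t * h t - f' t * h' t) with (f t * q + h' t * u) by (unfold q, u; ring).
      replace (f t * g t - f' t * g' t) with (f t * v + g' t * u) by (unfold v, u; ring).
      lra.
    - rewrite Ef, Eg, Eh. ring. }
  pose proof (pow2_ge_0 (f T - f' T)). pose proof (pow2_ge_0 (g T - g' T)). pose proof (pow2_ge_0 (h T - h' T)).
  assert (Z : forall a, a ^ 2 <= 0 -> a = 0).
  { intros a Ha. apply Rsqr_0_uniq. unfold Rsqr. nra. }
  repeat split; apply Rminus_diag_uniq, Z; lra.
Qed.

(** Induction along the interval: if the function had a zero, the supremum of the
    times before which it has none would be a first zero. *)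
Lemma nonvanishing_propagates (f : R -> R) (T : R) :
  (forall t, 0 <= t <= T -> continuous f t) ->
  (forall t, 0 <= t <= T -> (forall s, 0 <= s < t -> f s <> 0) -> f t <> 0) ->
  forall t, 0 <= t <= T -> f t <> 0.
Proof.
  intros Hc Hs t1 Ht1 Hz.
  set (E := fun t => 0 <= t <= t1 /\ forall s, 0 <= s < t -> f s <> 0).
  destruct (completeness E) as [m [Hub Hlub]].
  - exists t1. intros t [Ht _]. lra.
  - exists 0. split; [lra|intros; lra].
  - assert (Hm0 : 0 <= m). { apply Hub. split; [lra|intros; lra]. }
    assert (Hm1 : m <= t1). { apply Hlub. intros t [Ht _]; lra. }
    assert (Hlt : forall s, 0 <= s < m -> f s <> 0).
    { intros s Hs' Hfs. assert (m <= s); [|lra].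
      apply Hlub. intros t [Ht HE]. destruct (Rle_lt_dec t s); [easy|].
      exfalso. apply (HE s); lra || easy. }
    assert (Hfm : f m <> 0) by (apply Hs; lra || easy).
    assert (Hmt : m < t1). { destruct Hm1 as [|E1]; [easy|]. subst m; easy. }
    destruct (Hc m ltac:(lra) _ (open_neq 0 (f m) Hfm)) as [eps Heps].
    assert (HE : E (Rmin t1 (m + eps / 2))).
    { pose proof (cond_pos eps). split.
      - split; [apply Rmin_glb; lra|apply Rmin_l].
      - intros s Hs'. pose proof (Rmin_r t1 (m + eps / 2)).
        destruct (Rlt_le_dec s m); [apply Hlt; lra|].
        apply Heps. unfold ball; simpl; unfold AbsRing_ball, abs, minus, plus, opp; simpl.
        rewrite Rabs_pos_eq; lra. }
    apply Hub in HE. pose proof (cond_pos eps).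
    unfold Rmin in HE; destruct Rle_dec; lra.
Qed.

(** * The solution in closed form *)

(** For a possibly complex [w0] such that [sn w0 = r / x], [cn w0 = y / x] and
    [dn w0 = z / x], the solution is [r (ns, cs, ds) (w0 - r t)]. The addition
    theorems for [sn, cn, dn] give its coordinates as [r] times the numerators below
    over [sol_den], where [s, c, d] stand for [sn, cn, dn] at [r t]. *)
Definition sol_den (x y z r s c d : R) : R := r * x * c * d - y * z * s.
Definition sol_numx (x r k s : R) : R := x ^ 2 - k ^ 2 * r ^ 2 * s ^ 2.
Definition sol_numy (x y z r s c d : R) : R := x * y * c + r * z * s * d.
Definition sol_numz (x y z r k s c d : R) : R := x * z * d + k ^ 2 * r * y * s * c.

(** The conserved quantities of the field are [r^2] and [k^2 r^2]. With [z <> 0] the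
    cases of modulus [0 < k < 1] and [k = 0] are treated together. *)
Definition elliptic_parameters (x y z r k : R) : Prop :=
  0 < r /\ y ^ 2 = x ^ 2 - r ^ 2 /\ z ^ 2 = x ^ 2 - k ^ 2 * r ^ 2 /\ k ^ 2 < 1 /\ z <> 0.

Lemma elliptic_parameters_x_neq_0 (x y z r k : R) : elliptic_parameters x y z r k -> x <> 0.
Proof. intros (Hr & Hy & _) Hx. subst x. pose proof (pow2_ge_0 y). assert (0 < r ^ 2) by nra. lra. Qed.

Lemma elliptic_parameters_exist (x y z : R) : x ^ 2 > y ^ 2 -> x ^ 2 >= z ^ 2 -> z ^ 2 > y ^ 2 ->
  elliptic_parameters x y z (sqrt (x ^ 2 - y ^ 2)) (sqrt ((x ^ 2 - z ^ 2) / (x ^ 2 - y ^ 2))).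
Proof.
  intros Hxy Hxz Hzy.
  assert (Hk : 0 <= (x ^ 2 - z ^ 2) / (x ^ 2 - y ^ 2)).
  { apply Rmult_le_pos; [lra|]. left; apply Rinv_0_lt_compat; lra. }
  unfold elliptic_parameters. rewrite !pow2_sqrt by lra. repeat split.
  - apply sqrt_lt_R0; lra.
  - ring.
  - field. lra.
  - apply Rlt_div_l; lra.
  - intros Hz. rewrite Hz in Hzy. pose proof (pow2_ge_0 y). lra.
Qed.

Lemma is_derive_quotient (p q : R -> R) (t p' q' w : R) :
  is_derive p t p' -> is_derive q t q' -> q t <> 0 -> p' * q t - p t * q' = w ->
  is_derive (fun t => p t / q t) t (w / q t ^ 2).
Proof. intros Hp Hq H0 <-. now apply is_derive_div. Qed.

(** By the quotient rule each equation becomes a polynomial identity such as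
    [Nx' M - Nx M' = r Ny Nz] in [x, y, z, r, k, s, c, d], which holds modulo the four
    relations that express [y^2, z^2, c^2, d^2] through [x, r, k, s]. *)
Lemma closed_form_solves_at (x y z r k : R) (S C D : R -> R) (t : R) :
  y ^ 2 = x ^ 2 - r ^ 2 -> z ^ 2 = x ^ 2 - k ^ 2 * r ^ 2 ->
  C t ^ 2 = 1 - S t ^ 2 -> D t ^ 2 = 1 - k ^ 2 * S t ^ 2 ->
  is_derive S t (r * (C t * D t)) -> is_derive C t (r * (- S t * D t)) ->
  is_derive D t (r * (- k ^ 2 * S t * C t)) ->
  sol_den x y z r (S t) (C t) (D t) <> 0 ->
  solves_at (fun t => r * sol_numx x r k (S t) / sol_den x y z r (S t) (C t) (D t))
    (fun t => r * sol_numy x y z r (S t) (C t) (D t) / sol_den x y z r (S t) (C t) (D t))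
    (fun t => r * sol_numz x y z r k (S t) (C t) (D t) / sol_den x y z r (S t) (C t) (D t)) t.
Proof.
  intros Hy Hz Hc Hd HS HC HD H0.
  assert (Hq : is_derive (fun t => sol_den x y z r (S t) (C t) (D t)) t
    (r * (r * x * (- S t * D t ^ 2 - k ^ 2 * S t * C t ^ 2) - y * z * C t * D t))).
  { unfold sol_den. auto_derive; [repeat split; eexists; eassumption|].
    rewrite (Derive_eta_unique _ _ _ HS), (Derive_eta_unique _ _ _ HC), (Derive_eta_unique _ _ _ HD). ring. }
  split; [|split].
  - replace (_ * _) with (r ^ 2 * (sol_numy x y z r (S t) (C t) (D t) *
      sol_numz x y z r k (S t) (C t) (D t)) / sol_den x y z r (S t) (C t) (D t) ^ 2) by (field; easy).
    eapply (is_derive_quotient (fun t => r * sol_numx x r k (S t))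
      (fun t => sol_den x y z r (S t) (C t) (D t))); [|exact Hq|exact H0|].
    + unfold sol_numx. auto_derive; [repeat split; eexists; eassumption|].
      rewrite (Derive_eta_unique _ _ _ HS). reflexivity.
    + unfold sol_numx, sol_numy, sol_numz, sol_den. ring [Hy Hz Hc Hd].
  - replace (_ * _) with (r ^ 2 * (sol_numx x r k (S t) *
      sol_numz x y z r k (S t) (C t) (D t)) / sol_den x y z r (S t) (C t) (D t) ^ 2) by (field; easy).
    eapply (is_derive_quotient (fun t => r * sol_numy x y z r (S t) (C t) (D t))
      (fun t => sol_den x y z r (S t) (C t) (D t))); [|exact Hq|exact H0|].
    + unfold sol_numy. auto_derive; [repeat split; eexists; eassumption|].
      rewrite (Derive_eta_unique _ _ _ HS), (Derive_eta_unique _ _ _ HC), (Derive_eta_unique _ _ _ HD). reflexivity.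
    + unfold sol_numx, sol_numy, sol_numz, sol_den. ring [Hy Hz Hc Hd].
  - replace (_ * _) with (r ^ 2 * (sol_numx x r k (S t) *
      sol_numy x y z r (S t) (C t) (D t)) / sol_den x y z r (S t) (C t) (D t) ^ 2) by (field; easy).
    eapply (is_derive_quotient (fun t => r * sol_numz x y z r k (S t) (C t) (D t))
      (fun t => sol_den x y z r (S t) (C t) (D t))); [|exact Hq|exact H0|].
    + unfold sol_numz. auto_derive; [repeat split; eexists; eassumption|].
      rewrite (Derive_eta_unique _ _ _ HS), (Derive_eta_unique _ _ _ HC), (Derive_eta_unique _ _ _ HD). reflexivity.
    + unfold sol_numx, sol_numy, sol_numz, sol_den. ring [Hy Hz Hc Hd].
Qed.

Definition flow_den (x y z r k t : R) : R :=
  sol_den x y z r (jacobi_sn (r * t) k) (jacobi_cn (r * t) k) (jacobi_dn (r * t) k).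
Definition flow_numx (x r k t : R) : R := sol_numx x r k (jacobi_sn (r * t) k).
Definition flow_x (x y z r k t : R) : R := r * flow_numx x r k t / flow_den x y z r k t.
Definition flow_y (x y z r k t : R) : R :=
  r * sol_numy x y z r (jacobi_sn (r * t) k) (jacobi_cn (r * t) k) (jacobi_dn (r * t) k)
    / flow_den x y z r k t.
Definition flow_z (x y z r k t : R) : R :=
  r * sol_numz x y z r k (jacobi_sn (r * t) k) (jacobi_cn (r * t) k) (jacobi_dn (r * t) k)
    / flow_den x y z r k t.

Lemma is_derive_time_scale (f : R -> R) (r t l : R) :
  is_derive f (r * t) l -> is_derive (fun t => f (r * t)) t (r * l).
Proof.
  intros Hf. apply (is_derive_comp f (fun t => r * t) t l r Hf).
  auto_derive; [easy|ring].
Qed.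

Lemma flow_solves (x y z r k t : R) : elliptic_parameters x y z r k -> flow_den x y z r k t <> 0 ->
  solves_at (flow_x x y z r k) (flow_y x y z r k) (flow_z x y z r k) t.
Proof.
  intros (Hr & Hy & Hz & Hk & _) H0.
  apply (closed_form_solves_at x y z r k (fun t => jacobi_sn (r * t) k)
    (fun t => jacobi_cn (r * t) k) (fun t => jacobi_dn (r * t) k)); try easy.
  - apply jacobi_sn_cn_sqr.
  - now apply jacobi_dn_sqr.
  - now apply (is_derive_time_scale (fun u => jacobi_sn u k)), jacobi_sn_is_derive.
  - now apply (is_derive_time_scale (fun u => jacobi_cn u k)), jacobi_cn_is_derive.
  - now apply (is_derive_time_scale (fun u => jacobi_dn u k)), jacobi_dn_is_derive.
Qed.

Lemma flow_den_is_derive (x y z r k t : R) : elliptic_parameters x y z r k ->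
  is_derive (flow_den x y z r k) t
    (r * (- r * x * jacobi_sn (r * t) k * (jacobi_dn (r * t) k ^ 2 + k ^ 2 * jacobi_cn (r * t) k ^ 2)
      - y * z * jacobi_cn (r * t) k * jacobi_dn (r * t) k)).
Proof.
  intros (_ & _ & _ & Hk & _).
  pose proof (is_derive_time_scale (fun u => jacobi_sn u k) r t _ (jacobi_sn_is_derive k _ Hk)) as HS.
  pose proof (is_derive_time_scale (fun u => jacobi_cn u k) r t _ (jacobi_cn_is_derive k _ Hk)) as HC.
  pose proof (is_derive_time_scale (fun u => jacobi_dn u k) r t _ (jacobi_dn_is_derive k _ Hk)) as HD.
  unfold flow_den, sol_den. evar_last.
  - apply (is_derive_minus (fun t => r * x * jacobi_cn (r * t) k * jacobi_dn (r * t) k)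
      (fun t => y * z * jacobi_sn (r * t) k)).
    + apply (Derive.is_derive_mult (fun t => r * x * jacobi_cn (r * t) k)); [apply is_derive_scal, HC|exact HD].
    + apply is_derive_scal, HS.
  - unfold minus, plus, opp; simpl. ring.
Qed.

Lemma flow_den_continuous (x y z r k t : R) : elliptic_parameters x y z r k -> continuous (flow_den x y z r k) t.
Proof. intros H. apply (ex_derive_continuous (flow_den x y z r k)). eexists; now apply flow_den_is_derive. Qed.

Lemma flow_numx_continuous (x r k t : R) : k ^ 2 < 1 -> continuous (flow_numx x r k) t.
Proof.
  intros Hk. apply (ex_derive_continuous (flow_numx x r k)).
  pose proof (is_derive_time_scale (fun u => jacobi_sn u k) r t _ (jacobi_sn_is_derive k _ Hk)) as HS.
  unfold flow_numx, sol_numx. set (S := fun t => jacobi_sn (r * t) k) in *.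
  change (ex_derive (fun t => x ^ 2 - k ^ 2 * r ^ 2 * S t ^ 2) t).
  auto_derive. repeat split; eexists; exact HS.
Qed.

(** * Zeros of the denominators *)

(** The numerator equals [x^2 cn^2 + z^2 sn^2]; hence every zero of [flow_den] is a
    genuine blow-up of the first coordinate. *)
Lemma flow_numx_pos (x y z r k t : R) : elliptic_parameters x y z r k -> 0 < flow_numx x r k t.
Proof.
  intros Hd. pose proof (elliptic_parameters_x_neq_0 _ _ _ _ _ Hd) as Hx. destruct Hd as (_ & _ & Hz & _ & Hz0).
  unfold flow_numx, sol_numx.
  pose proof (jacobi_sn_cn_sqr (r * t) k) as Hc. set (s := jacobi_sn _ _) in *. set (c := jacobi_cn _ _) in *.
  replace (x ^ 2 - k ^ 2 * r ^ 2 * s ^ 2) with (x ^ 2 * c ^ 2 + z ^ 2 * s ^ 2) by (rewrite Hc, Hz; ring).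
  pose proof (pow2_gt_0 x Hx). pose proof (pow2_gt_0 z Hz0).
  pose proof (pow2_ge_0 c). pose proof (pow2_ge_0 s).
  destruct (Req_dec s 0) as [E|E].
  - rewrite E in *. nra.
  - pose proof (pow2_gt_0 s E). nra.
Qed.

Lemma flow_at_0 (x y z r k : R) : elliptic_parameters x y z r k ->
  flow_den x y z r k 0 = r * x /\ flow_x x y z r k 0 = x /\ flow_y x y z r k 0 = y /\ flow_z x y z r k 0 = z.
Proof.
  intros Hd. pose proof (elliptic_parameters_x_neq_0 _ _ _ _ _ Hd) as Hx. destruct Hd as (Hr & _ & _ & Hk & _).
  unfold flow_x, flow_y, flow_z, flow_den, flow_numx, sol_den, sol_numx, sol_numy, sol_numz.
  rewrite Rmult_0_r. destruct (jacobi_at_0 k Hk) as (-> & -> & ->).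
  repeat split; field; repeat split; lra.
Qed.

Lemma flow_den_reverse (x y z r k t : R) : k ^ 2 < 1 ->
  flow_den x y z r k (- t) = r * x * jacobi_cn (r * t) k * jacobi_dn (r * t) k + y * z * jacobi_sn (r * t) k.
Proof.
  intros Hk. unfold flow_den, sol_den. replace (r * - t) with (- (r * t)) by ring.
  destruct (jacobi_parity (r * t) k Hk) as (-> & -> & ->). ring.
Qed.

(** Links the two closed forms of the first coordinate. The factor at [- t] is the
    denominator of the time-reversed solution; it cancels against the numerator of
    the elliptic quotient. *)
Lemma flow_den_factor (x y z r k t : R) : elliptic_parameters x y z r k ->
  (r ^ 2 - x ^ 2 * jacobi_sn (r * t) k ^ 2) * flow_numx x r k t =
    flow_den x y z r k t * flow_den x y z r k (- t).
Proof.
  intros (_ & Hy & Hz & Hk & _). rewrite flow_den_reverse by easy.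
  unfold flow_den, sol_den, flow_numx, sol_numx.
  pose proof (jacobi_sn_cn_sqr (r * t) k) as Hc. pose proof (jacobi_dn_sqr (r * t) k Hk) as Hd'.
  ring [Hy Hz Hc Hd'].
Qed.

(** A common zero of the denominator and its derivative would give
    [sn * (r^2 x^2 (dn^2 + k^2 cn^2) + y^2 z^2) = 0], hence [sn = 0], and then
    [cn dn <> 0] contradicts the vanishing of the denominator. *)
Lemma flow_den_simple_zeros (x y z r k t l : R) : elliptic_parameters x y z r k ->
  is_derive (flow_den x y z r k) t l -> flow_den x y z r k t = 0 -> l <> 0.
Proof.
  intros Hd Hl H0 El. pose proof (elliptic_parameters_x_neq_0 _ _ _ _ _ Hd) as Hx.
  assert (E : l = r * (- r * x * jacobi_sn (r * t) k * (jacobi_dn (r * t) k ^ 2 + k ^ 2 * jacobi_cn (r * t) k ^ 2)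
      - y * z * jacobi_cn (r * t) k * jacobi_dn (r * t) k)).
  { rewrite <- (is_derive_unique _ _ _ Hl). now apply is_derive_unique, flow_den_is_derive. }
  rewrite El in E. clear Hl El l. destruct Hd as (Hr & _ & _ & Hk & _).
  unfold flow_den, sol_den in H0.
  pose proof (jacobi_sn_cn_sqr (r * t) k) as Hc. pose proof (jacobi_dn_pos (r * t) k Hk) as Hp.
  set (s := jacobi_sn _ _) in *. set (c := jacobi_cn _ _) in *. set (d := jacobi_dn _ _) in *.
  assert (Hs : s * (r ^ 2 * x ^ 2 * (d ^ 2 + k ^ 2 * c ^ 2) + y ^ 2 * z ^ 2) = 0).
  { replace (s * _) with (- x * (r * (- r * x * s * (d ^ 2 + k ^ 2 * c ^ 2) - y * z * c * d))
      - y * z * (r * x * c * d - y * z * s)) by ring.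
    rewrite <- E, H0. ring. }
  assert (Hpos : 0 < r ^ 2 * x ^ 2 * (d ^ 2 + k ^ 2 * c ^ 2) + y ^ 2 * z ^ 2).
  { rewrite <- !Rpow_mult_distr. pose proof (pow2_ge_0 (k * c)). pose proof (pow2_ge_0 (y * z)).
    assert (0 < (r * x) ^ 2) by (apply pow2_gt_0, Rmult_integral_contrapositive; split; lra).
    assert (0 < d ^ 2) by (apply pow_lt; easy). nra. }
  apply Rmult_integral in Hs. destruct Hs as [Hs|Hs]; [|lra].
  rewrite Hs in H0, Hc. assert (c <> 0) by (intros Ec; rewrite Ec in Hc; lra).
  assert (r * x * c * d <> 0) by (repeat apply Rmult_integral_contrapositive_currified; lra).
  lra.
Qed.

(** * Comparison of the closed form with the flow *)

(** The field is homogeneous of degree 2, so [s |-> t * gamma (t s)] is again an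
    integral curve: the flow at a scaled point is the scaled flow at a scaled time. *)
Lemma time_one_curve (f g h : R -> R) (t a b : R) : a < 0 -> 1 < b ->
  (forall s, a < s < b -> solves_at f g h (t * s)) ->
  time_one tetrahedral_field (f 0 * t, g 0 * t, h 0 * t) (t * f t, t * g t, t * h t).
Proof.
  intros Ha Hb H.
  exists (fun s => (t * f (t * s), t * g (t * s), t * h (t * s))), a, b.
  split; [easy|]. split; [easy|]. split; [|split].
  - intros s Hs. refine (proj2 (is_derive_tetrahedral_iff _ s) _). cbn [fst snd].
    destruct (H s Hs) as (H1 & H2 & H3).
    split; [|split].
    + replace (_ * _) with (t * (t * (g (t * s) * h (t * s)))) by ring.
      now apply is_derive_scal, is_derive_time_scale.
    + replace (_ * _) with (t * (t * (f (t * s) * h (t * s)))) by ring.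
      now apply is_derive_scal, is_derive_time_scale.
    + replace (_ * _) with (t * (t * (f (t * s) * g (t * s)))) by ring.
      now apply is_derive_scal, is_derive_time_scale.
  - rewrite Rmult_0_r, !(Rmult_comm t). easy.
  - now rewrite Rmult_1_r.
Qed.

Lemma time_one_rotate (p q : R * R * R) : time_one tetrahedral_field p q ->
  time_one tetrahedral_field (snd (fst p), snd p, fst (fst p)) (snd (fst q), snd q, fst (fst q)).
Proof.
  intros (gamma & a & b & Ha & Hb & Hg & <- & <-).
  exists (fun t => (snd (fst (gamma t)), snd (gamma t), fst (fst (gamma t)))), a, b.
  split; [easy|]. split; [easy|]. split; [|easy].
  intros t Ht. refine (proj2 (is_derive_tetrahedral_iff _ t) _). cbn [fst snd].
  destruct (proj1 (is_derive_tetrahedral_iff _ _) (Hg t Ht)) as (H1 & H2 & H3).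
  split; [|split]; [rewrite Rmult_comm; exact H2|rewrite Rmult_comm; exact H3|exact H1].
Qed.

Lemma continuous_locally_neq (f : R -> R) (t a : R) : continuous f t -> f t <> a ->
  exists eps : R, 0 < eps /\ forall s, Rabs (s - t) < eps -> f s <> a.
Proof.
  intros Hf Ha. destruct (Hf _ (open_neq a (f t) Ha)) as [eps Heps].
  exists eps. split; [apply cond_pos|]. intros s Hs. now apply Heps.
Qed.

Lemma zero_by_continuity (f : R -> R) (t : R) : 0 < t -> continuous f t ->
  (forall s, 0 <= s < t -> f s = 0) -> f t = 0.
Proof.
  intros Ht Hf Hs. destruct (Req_dec (f t) 0) as [E|E]; [easy|].
  destruct (continuous_locally_neq f t 0 Hf E) as [eps [He Hn]]. exfalso.
  apply (Hn (Rmax 0 (t - eps / 2))).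
  - apply Rabs_def1; destruct (Rle_lt_dec 0 (t - eps / 2));
      [rewrite Rmax_right|rewrite Rmax_left|rewrite Rmax_right|rewrite Rmax_left]; lra.
  - apply Hs. split; [apply Rmax_l|]. apply Rmax_lub_lt; lra.
Qed.

(** The closed form can only break down where the true solution does. Up to a first
    zero of the denominator, uniqueness gives [f * flow_den = r * flow_numx]; this
    persists in the limit, where the left side would vanish and the right side is
    positive. *)
Lemma flow_den_nonzero (x y z r k : R) (f g h : R -> R) (T : R) : elliptic_parameters x y z r k ->
  (forall t, 0 <= t <= T -> solves_at f g h t) -> f 0 = x -> g 0 = y -> h 0 = z ->
  forall t, 0 <= t <= T -> flow_den x y z r k t <> 0.
Proof.
  intros Hd H Ef Eg Eh. destruct (flow_at_0 _ _ _ _ _ Hd) as (E0 & Ex & Ey & Ez).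
  apply nonvanishing_propagates; [intros; now apply flow_den_continuous|].
  intros t Ht Hlt Hz.
  assert (Hk : k ^ 2 < 1) by (now destruct Hd as (_ & _ & _ & ? & _)).
  assert (Hr : 0 < r) by (now destruct Hd as (? & _)).
  pose proof (elliptic_parameters_x_neq_0 _ _ _ _ _ Hd) as Hx.
  destruct (proj1 Ht) as [Htpos|<-].
  2: { rewrite E0 in Hz. apply Rmult_integral in Hz. lra. }
  assert (E : f t * flow_den x y z r k t - r * flow_numx x r k t = 0).
  { apply (zero_by_continuity (fun t => f t * flow_den x y z r k t - r * flow_numx x r k t)); [easy| |].
    - apply (continuous_minus (fun t => f t * flow_den x y z r k t) (fun t => r * flow_numx x r k t)).
      + apply (continuous_mult f (flow_den x y z r k)); [|now apply flow_den_continuous].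
        now apply (solves_continuous f g h), H.
      + apply (continuous_mult (fun _ => r) (flow_numx x r k)); [apply continuous_const|].
        now apply flow_numx_continuous.
    - intros s Hs.
      destruct (solution_unique f g h (flow_x x y z r k) (flow_y x y z r k) (flow_z x y z r k) s) as [-> _];
        try congruence; try lra.
      + intros u Hu. apply H. lra.
      + intros u Hu. apply flow_solves; [easy|]. apply Hlt. lra.
      + unfold flow_x. field. now apply Hlt. }
  rewrite Hz in E. pose proof (flow_numx_pos _ _ _ _ _ t Hd).
  assert (0 < r * flow_numx x r k t) by (now apply Rmult_lt_0_compat). lra.
Qed.

Lemma is_derive_locally'_neq (f : R -> R) (t l : R) : is_derive f t l -> (f t = 0 -> l <> 0) ->
  exists eps : R, 0 < eps /\ forall s, 0 < Rabs (s - t) < eps -> f s <> 0.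
Proof.
  intros Hf Hl. destruct (Req_dec (f t) 0) as [E|E].
  - specialize (Hl E). apply is_derive_Reals in Hf.
    destruct (Hf (Rabs l) (Rabs_pos_lt _ Hl)) as [eps Heps].
    exists eps. split; [apply cond_pos|]. intros s Hs Hz.
    specialize (Heps (s - t)). replace (t + (s - t)) with s in Heps by ring.
    rewrite E, Hz in Heps. replace ((0 - 0) / (s - t) - l) with (- l) in Heps by (unfold Rdiv; ring).
    rewrite Rabs_Ropp in Heps. apply (Rlt_irrefl (Rabs l)), Heps; [|easy].
    intros E'. rewrite E', Rabs_R0 in Hs. lra.
  - destruct (continuous_locally_neq f t 0) as [eps [He Hn]]; [|easy|].
    + apply (ex_derive_continuous f). now exists l.
    + exists eps. split; [easy|]. intros s Hs. apply Hn, Hs.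
Qed.

(** * The elliptic quotient *)

Definition jacobi_num (x y z : R) : R :=
  let v := sqrt (x ^ 2 - y ^ 2) in
  let k := sqrt ((x ^ 2 - z ^ 2) / (x ^ 2 - y ^ 2)) in
  x * (x ^ 2 - y ^ 2) * jacobi_sn' v k + y * z * sqrt (x ^ 2 - y ^ 2) * jacobi_sn v k.

Definition jacobi_den (x y z : R) : R :=
  let v := sqrt (x ^ 2 - y ^ 2) in
  let k := sqrt ((x ^ 2 - z ^ 2) / (x ^ 2 - y ^ 2)) in
  x ^ 2 - y ^ 2 - x ^ 2 * jacobi_sn v k ^ 2.

(** Along the line through [(x, y, z)] the modulus is constant, and
    [sqrt ((x t)^2 - (y t)^2) = |t| r]; by parity the sign of [t] drops out. *)
Lemma jacobi_scaled (x y z t : R) : t <> 0 ->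
  let r := sqrt (x ^ 2 - y ^ 2) in
  let k := sqrt ((x ^ 2 - z ^ 2) / (x ^ 2 - y ^ 2)) in
  elliptic_parameters x y z r k ->
  jacobi_num (x * t) (y * t) (z * t) = t ^ 3 * (r * flow_den x y z r k (- t)) /\
  jacobi_den (x * t) (y * t) (z * t) = t ^ 2 * (r ^ 2 - x ^ 2 * jacobi_sn (r * t) k ^ 2).
Proof.
  intros Ht r k Hd.
  assert (Hr2 : x ^ 2 - y ^ 2 = r ^ 2) by (destruct Hd as (_ & E & _); rewrite E; ring).
  destruct Hd as (Hr & _ & _ & Hk & _).
  unfold jacobi_num, jacobi_den.
  replace ((x * t) ^ 2 - (y * t) ^ 2) with (t ^ 2 * (x ^ 2 - y ^ 2)) by ring.
  replace ((x * t) ^ 2 - (z * t) ^ 2) with (t ^ 2 * (x ^ 2 - z ^ 2)) by ring.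
  replace (t ^ 2 * (x ^ 2 - z ^ 2) / (t ^ 2 * (x ^ 2 - y ^ 2))) with ((x ^ 2 - z ^ 2) / (x ^ 2 - y ^ 2)).
  2: { rewrite Hr2. field. split; [lra|easy]. }
  fold k. rewrite Hr2. rewrite <- Rpow_mult_distr. rewrite <- Rsqr_pow2, sqrt_Rsqr_abs.
  cbv zeta. rewrite jacobi_sn'_eq, flow_den_reverse by easy. rewrite Rsqr_pow2.
  destruct (jacobi_parity (r * t) k Hk) as (Es & Ec & Ed).
  destruct (Rle_lt_dec 0 (t * r)) as [Hp|Hn].
  - rewrite Rabs_pos_eq, (Rmult_comm t r) by easy. split; ring.
  (* The sign lost in [|t|] comes back through the oddness of [sn]. *)
  - rewrite Rabs_left by easy. replace (- (t * r)) with (- (r * t)) by ring.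
    rewrite Es, Ec, Ed. split; ring.
Qed.

Lemma jacobi_quotient (x y z t : R) : t <> 0 ->
  let r := sqrt (x ^ 2 - y ^ 2) in
  let k := sqrt ((x ^ 2 - z ^ 2) / (x ^ 2 - y ^ 2)) in
  elliptic_parameters x y z r k -> flow_den x y z r k t <> 0 ->
  (jacobi_den (x * t) (y * t) (z * t) <> 0 <-> flow_den x y z r k (- t) <> 0) /\
  (flow_den x y z r k (- t) <> 0 ->
   jacobi_num (x * t) (y * t) (z * t) / jacobi_den (x * t) (y * t) (z * t) = t * flow_x x y z r k t).
Proof.
  intros Ht r k Hd H0. destruct (jacobi_scaled x y z t Ht Hd) as [-> ->]. fold r k.
  pose proof (flow_den_factor x y z r k t Hd) as HF.
  pose proof (flow_numx_pos x y z r k t Hd) as HG.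
  assert (E : r ^ 2 - x ^ 2 * jacobi_sn (r * t) k ^ 2 =
    flow_den x y z r k t * flow_den x y z r k (- t) / flow_numx x r k t).
  { rewrite <- HF. field. lra. }
  rewrite E. clear E HF. split; [split|].
  - intros H1 H2. apply H1. rewrite H2. field. lra.
  - intros H1. unfold Rdiv. apply Rmult_integral_contrapositive_currified; [now apply pow_nonzero|].
    repeat apply Rmult_integral_contrapositive_currified; try easy.
    apply Rinv_neq_0_compat. lra.
  - intros H1. unfold flow_x. field. repeat split; try easy. lra.
Qed.

(** For small [t] the closed form itself is an integral curve through the scaled
    point. At [(x, y, z)] the given curve is the only information, and it is
    compared with the closed form by uniqueness. The condition [x^2 >= z^2] lets in
    the modulus [0] of the trigonometric case. *)
Lemma jacobi_formula (phi : R * R * R -> R * R * R)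
  (Hphi : forall p q, time_one tetrahedral_field p q -> phi p = q) (x y z : R) :
  x ^ 2 > y ^ 2 -> x ^ 2 >= z ^ 2 -> z ^ 2 > y ^ 2 ->
  equals_quotient (fun x y z => fst (fst (phi (x, y, z)))) jacobi_num jacobi_den x y z.
Proof.
  intros Hxy Hxz Hzy. pose proof (elliptic_parameters_exist x y z Hxy Hxz Hzy) as Hd.
  set (r := sqrt (x ^ 2 - y ^ 2)) in Hd.
  set (k := sqrt ((x ^ 2 - z ^ 2) / (x ^ 2 - y ^ 2))) in Hd.
  pose proof (elliptic_parameters_x_neq_0 _ _ _ _ _ Hd) as Hx.
  assert (Hr : 0 < r) by (now destruct Hd as (? & _)).
  destruct (flow_at_0 _ _ _ _ _ Hd) as (E0 & Ex & Ey & Ez).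
  split.
  - destruct (continuous_locally_neq (flow_den x y z r k) 0 0) as [eps [He Hn]].
    + now apply flow_den_continuous.
    + rewrite E0. apply Rmult_integral_contrapositive; split; lra.
    + exists (eps / 2). split; [lra|]. intros t [Ht0 Ht].
      assert (Ht1 : t <> 0) by (intros ->; rewrite Rabs_R0 in Ht0; lra).
      assert (Hn' : forall s, Rabs s <= 2 -> flow_den x y z r k (t * s) <> 0).
      { intros s Hs. apply Hn. rewrite Rminus_0_r, Rabs_mult.
        pose proof (Rabs_pos s). nra. }
      assert (Hm : flow_den x y z r k (- t) <> 0).
      { replace (- t) with (t * (- 1)) by ring. apply Hn', Rabs_le; lra. }
      assert (Hp : flow_den x y z r k t <> 0).
      { rewrite <- (Rmult_1_r t). apply Hn', Rabs_le; lra. }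
      destruct (jacobi_quotient x y z t Ht1 Hd Hp) as [HD HQ].
      split; [now apply HD|]. rewrite HQ by easy.
      assert (HT : time_one tetrahedral_field (x * t, y * t, z * t)
        (t * flow_x x y z r k t, t * flow_y x y z r k t, t * flow_z x y z r k t)).
      { rewrite <- Ex at 1. rewrite <- Ey at 2. rewrite <- Ez at 3.
        apply (time_one_curve _ _ _ t (- 1) 2); try lra.
        (* The scaled curve lives on (-1, 2), which is why times up to [2 |t|] matter. *)
        intros s Hs. apply flow_solves; [easy|]. apply Hn', Rabs_le; lra. }
      now rewrite (Hphi _ _ HT).
  - intros [q Hq]. pose proof (Hphi _ _ Hq) as Hpq.
    destruct Hq as (gamma & a & b & Ha & Hb & Hg & Hg0 & Hg1).
    set (f := fun t => fst (fst (gamma t))). set (g := fun t => snd (fst (gamma t))).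
    set (h := fun t => snd (gamma t)).
    assert (Hs : forall t, 0 <= t <= 1 -> solves_at f g h t).
    { intros t Ht. apply (proj1 (is_derive_tetrahedral_iff gamma t)), Hg. lra. }
    assert (F0 : f 0 = x /\ g 0 = y /\ h 0 = z) by (unfold f, g, h; now rewrite Hg0).
    destruct F0 as (F0 & G0 & H0).
    pose proof (flow_den_nonzero x y z r k f g h 1 Hd Hs F0 G0 H0) as Hn.
    assert (E1 : fst (fst (phi (x, y, z))) = flow_x x y z r k 1).
    { rewrite Hpq, <- Hg1.
      apply (solution_unique f g h (flow_x x y z r k) (flow_y x y z r k) (flow_z x y z r k) 1);
        try congruence; try lra; [exact Hs|].
      intros t Ht. apply flow_solves; [easy|]. now apply Hn. }
    rewrite E1. split.
    + intros HD. destruct (jacobi_quotient x y z 1 R1_neq_R0 Hd (Hn 1 ltac:(lra))) as [HD' HQ].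
      rewrite !Rmult_1_r, Rmult_1_l in *. symmetry. now apply HQ, HD'.
    + apply (is_lim_ext_loc (fun t => t * flow_x x y z r k t)).
      * destruct (continuous_locally_neq (flow_den x y z r k) 1 0) as [e1 [He1 Hn1]];
          [now apply flow_den_continuous|apply Hn; lra|].
        (* The quotient may degenerate at [t = 1] itself, but only at an isolated zero of
           the cancelling factor. *)
        destruct (is_derive_locally'_neq (flow_den x y z r k) (- 1) _
          (flow_den_is_derive x y z r k (- 1) Hd)) as [e2 [He2 Hn2]].
        { apply (flow_den_simple_zeros x y z r k); [easy|]. now apply flow_den_is_derive. }
        assert (Hmin : 0 < Rmin 1 (Rmin e1 e2)) by (repeat apply Rmin_glb_lt; lra).
        exists (mkposreal _ Hmin). intros t Ht Ht1.
        change (Rabs (t - 1) < Rmin 1 (Rmin e1 e2)) in Ht.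
        pose proof (Rmin_l 1 (Rmin e1 e2)). pose proof (Rmin_r 1 (Rmin e1 e2)).
        pose proof (Rmin_l e1 e2). pose proof (Rmin_r e1 e2).
        symmetry. apply jacobi_quotient; try easy.
        -- apply Rabs_def2 in Ht. lra.
        -- apply Hn1. lra.
        -- apply Hn2. replace (- t - - 1) with (- (t - 1)) by ring. rewrite Rabs_Ropp.
           split; [|lra]. apply Rabs_pos_lt. lra.
      * assert (HC : continuous (fun t => t * flow_x x y z r k t) 1).
        { apply (continuous_mult (fun t => t) (flow_x x y z r k)); [apply continuous_id|].
          apply (solves_continuous _ (flow_y x y z r k) (flow_z x y z r k)), flow_solves; [easy|apply Hn; lra]. }
        apply continuity_pt_filterlim, is_lim_continuity in HC.
        now rewrite Rmult_1_l in HC.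
Qed.

Lemma equals_quotient_ext (U n d n' d' : R -> R -> R -> R) (x y z : R) :
  (forall t, n (x * t) (y * t) (z * t) = n' (x * t) (y * t) (z * t)) ->
  (forall t, d (x * t) (y * t) (z * t) = d' (x * t) (y * t) (z * t)) ->
  equals_quotient U n d x y z -> equals_quotient U n' d' x y z.
Proof.
  intros Hn Hd [(eps & He & H1) H2].
  assert (Hn1 := Hn 1). assert (Hd1 := Hd 1). rewrite !Rmult_1_r in Hn1, Hd1.
  split.
  - exists eps. split; [easy|]. intros t Ht. rewrite <- Hn, <- Hd. now apply H1.
  - intros HD. destruct (H2 HD) as [H3 H4]. rewrite <- Hn1, <- Hd1. split; [easy|].
    revert H4. apply is_lim_ext. intros t. now rewrite Hn, Hd.
Qed.

Theorem theorem4p3 (phi : R * R * R -> R * R * R) (Hphi : tetrahedral_superflow phi) :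
  let U := fun x y z : R => fst (fst (phi (x, y, z))) in
  (forall x y z : R, flow_domain tetrahedral_field (x, y, z) ->
     phi (x, y, z) = (U x y z, U y z x, U z x y)) /\
  (forall x y z : R, x ^ 2 > z ^ 2 -> z ^ 2 > y ^ 2 ->
     equals_quotient U
       (fun x y z : R =>
          let v := sqrt (x ^ 2 - y ^ 2) in
          let k := sqrt ((x ^ 2 - z ^ 2) / (x ^ 2 - y ^ 2)) in
          x * (x ^ 2 - y ^ 2) * jacobi_sn' v k
          + y * z * sqrt (x ^ 2 - y ^ 2) * jacobi_sn v k)
       (fun x y z : R =>
          let v := sqrt (x ^ 2 - y ^ 2) in
          let k := sqrt ((x ^ 2 - z ^ 2) / (x ^ 2 - y ^ 2)) in
          x ^ 2 - y ^ 2 - x ^ 2 * jacobi_sn v k ^ 2)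
       x y z) /\
  (forall x y z : R, x ^ 2 > y ^ 2 -> z = x ->
     equals_quotient U
       (fun x y _ : R =>
          x * (x ^ 2 - y ^ 2) * cos (sqrt (x ^ 2 - y ^ 2))
          + x * y * sqrt (x ^ 2 - y ^ 2) * sin (sqrt (x ^ 2 - y ^ 2)))
       (fun x y _ : R =>
          x ^ 2 * cos (sqrt (x ^ 2 - y ^ 2)) ^ 2 - y ^ 2)
       x y z).
Proof.
  intros U. destruct Hphi as (_ & _ & Hphi). split; [|split].
  - intros x y z [q Hq]. unfold U.
    pose proof (time_one_rotate _ _ Hq) as Hq1. pose proof (time_one_rotate _ _ Hq1) as Hq2.
    cbn [fst snd] in Hq1, Hq2.
    rewrite (Hphi _ _ Hq), (Hphi _ _ Hq1), (Hphi _ _ Hq2). now destruct q as [[q1 q2] q3].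
  - intros x y z Hxz Hzy. apply (jacobi_formula phi Hphi); lra.
  - intros x y z Hxy ->.
    assert (Hk : forall t, sqrt (((x * t) ^ 2 - (x * t) ^ 2) / ((x * t) ^ 2 - (y * t) ^ 2)) = 0).
    { intros t. rewrite Rminus_diag. unfold Rdiv. rewrite Rmult_0_l. apply sqrt_0. }
    apply (equals_quotient_ext U jacobi_num jacobi_den).
    + intros t. unfold jacobi_num. cbv zeta. rewrite Hk.
      destruct (jacobi_modulus_0 (sqrt ((x * t) ^ 2 - (y * t) ^ 2))) as [-> ->]. ring.
    + intros t. unfold jacobi_den. cbv zeta. rewrite Hk.
      destruct (jacobi_modulus_0 (sqrt ((x * t) ^ 2 - (y * t) ^ 2))) as [-> _].
      set (v := sqrt _). pose proof (sin2_cos2 v) as Hv. rewrite !Rsqr_pow2 in Hv.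
      replace (sin v ^ 2) with (1 - cos v ^ 2) by lra. ring.
    + apply (jacobi_formula phi Hphi); lra.
Qed.
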